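(* Consider on a single element $E$ the flux-differencing semi-discretization $$ \begin{aligned} \omega_i\omega_j J_{ij}\frac{\mathrm d}{\mathrm dt}\boldsymbol u_{ij} &= \omega_j\Big(-\sum_{m=0}^N S_{im}(J\boldsymbol f^1)^{\#}_{ij,mj}+\delta_{i0}(J\boldsymbol f^1)^{*}_{0j,0j^+}-\delta_{iN}(J\boldsymbol f^1)^{*}_{Nj,Nj^+}\Big)\\ &\quad+\omega_i\Big(-\sum_{m=0}^N S_{jm}(J\boldsymbol f^2)^{\#}_{ij,im}+\delta_{j0}(J\boldsymbol f^2)^{*}_{i0,i0^+}-\delta_{jN}(J\boldsymbol f^2)^{*}_{iN,iN^+}\Big)+\omega_i\omega_jJ_{ij}\boldsymbol s_{ij},\quad 0\le i,j\le N, \end{aligned} $$ with $\boldsymbol u_{ij}=(h_{ij},(hv^1)_{ij},(hv^2)_{ij})^{\mathrm T}$ and with source term $\boldsymbol s=(0,s^1,s^2)^{\mathrm T}$, where $$s^i=-\tfrac12\big(\Gamma^i_{jk}hv^jv^k-G^{ik}\Gamma^l_{jk}hv^jv_l\big)-fJG^{ij}\varepsilon_{jk}hv^k .$$ For states $L,R$ define the numerical entropy flux $$(JF^j)^{*}_{L,R}=\tfrac12\Big[\boldsymbol w_L^{\mathrm T}(J\boldsymbol f^j)^{*}_{L,R}+\boldsymbol w_R^{\mathrm T}(J\boldsymbol f^j)^{*}_{R,L}\Big]-\tfrac12\Big[(J\varPsi^j)_L+(J\varPsi^j)_R\Big]$$ and the numerical entropy production terms $$r^{j\#}_{L,R}=\Big[\boldsymbol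 w_R^{\mathrm T}(J\boldsymbol f^j)^{\#}_{R,L}-\boldsymbol w_L^{\mathrm T}(J\boldsymbol f^j)^{\#}_{L,R}\Big]-\Big[(J\varPsi^j)_R-(J\varPsi^j)_L\Big],$$ $$r^{j*}_{L,R}=\Big[\boldsymbol w_R^{\mathrm T}(J\boldsymbol f^j)^{*}_{R,L}-\boldsymbol w_L^{\mathrm T}(J\boldsymbol f^j)^{*}_{L,R}\Big]-\Big[(J\varPsi^j)_R-(J\varPsi^j)_L\Big].$$ Then the time rate of change of the integrated mathematical entropy on $E$ is $$ \begin{aligned} \frac{\mathrm d}{\mathrm dt}I_E[\eta]&=\sum_{j=0}^N\omega_j\Big[(JF^1)^{*}_{0j,0j^+}-(JF^1)^{*}_{Nj,Nj^+}\Big]+\sum_{i=0}^N\omega_i\Big[(JF^2)^{*}_{i0,i0^+}-(JF^2)^{*}_{iN,iN^+}\Big]\\ &\quad+\frac12\sum_{j=0}^N\omega_j\Big(r^{1*}_{0j^+,0j}+r^{1*}_{Nj,Nj^+}\Big)+\frac12\sum_{i=0}^N\omega_i\Big(r^{2*}_{i0^+,i0}+r^{2*}_{iN,iN^+}\Big)\\ &\quad+\sum_{i,j,m=0}^N\omega_i\omega_j\Big(D_{im}r^{1\#}_{ij,mj}+D_{jm}r^{2\#}_{ij,im}\Big). \end{aligned} $$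
   Context: Summation over Latin indices in $\{1,2\}$ repeated in upper and lower positions is implied for tensor components (not for node indices). The element $E$ of a mesh of a surface $S\subset\mathbb R^3$ is the image of $[-1,1]^2$ (coordinates $\xi^1,\xi^2$) under a smooth, bijective, time-invariant mapping $\vec X$. With $\vec a_i=\partial_i\vec X$: $G_{ij}=\vec a_i\cdot\vec a_j$, $\boldsymbol G=(G_{ij})$ is symmetric positive definite with inverse $(G^{ij})$, $J=\sqrt{\det\boldsymbol G}$, $\Gamma^i_{jk}=\frac12G^{il}(\partial_jG_{kl}+\partial_kG_{jl}-\partial_lG_{jk})$. Velocity: contravariant components $v^i$, covariant components $v_i=G_{ij}v^j$. $h>0$ is fluid depth, $g>0$ constant gravity, $b$ the time-independent bottom topography, $f$ the time-independent Coriolis parameter, $\varepsilon_{12}=1$, $\varepsilon_{21}=-1$, $\varepsilon_{11}=\varepsilon_{22}=0$. The entropy (total energy) is $\eta=\frac12hv_iv^i+\frac12gh^2+ghb$, viewed as a function of $\boldsymbol u=(h,hv^1,hv^2)^{\mathrm T}$. The entropy variables are $\boldsymbol w=\partial\eta/\partial\boldsymbol u=\big(g(h+b)-\frac12(v_1v^1+v_2v^2),\,v_1,\,v_2\big)^{\mathrm T}$. The flux potential components are $\varPsi^j=\frac12gh^2v^j$. Let $\{\xi_i\}_{i=0}^N\subset[-1,1]$ be the Legendre--Gauss--Lobatto nodes (including endpoints) with positive weights $\omega_i$ and Lagrange polynomials $\ell_i$. $(\cdot)_{ij}$ denotes a quantity at $(\xi_i,\xi_j)$. Matrices (zero-based indices):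 $D_{ij}=\ell_j'(\xi_i)$, $M_{ij}=\omega_i\delta_{ij}$, $\boldsymbol Q=\boldsymbol M\boldsymbol D$, $\boldsymbol B=\mathrm{diag}(-1,0,\dots,0,1)$, $\boldsymbol S=2\boldsymbol Q-\boldsymbol B$. They satisfy $\boldsymbol Q+\boldsymbol Q^{\mathrm T}=\boldsymbol B$ and $\sum_mD_{im}=0$. The volume fluxes $(J\boldsymbol f^k)^{\#}_{L,R}$ and interface fluxes $(J\boldsymbol f^k)^{*}_{L,R}$, $k=1,2$, are $\mathbb R^3$-valued functions of $(\boldsymbol u,\boldsymbol G,b)_L$ and $(\boldsymbol u,\boldsymbol G,b)_R$, not necessarily symmetric. For example $(J\boldsymbol f^1)^{\#}_{ij,mj}$ has left state at node $(\xi_i,\xi_j)$ and right state at node $(\xi_m,\xi_j)$. A subscript with superscript ''$+$'' denotes the external state at the coincident node of the adjacent element, with momentum components transformed to the local coordinate system of the interior node. The discrete element integral is $I_E[\eta]=\sum_{i,j=0}^N\omega_i\omega_jJ_{ij}\eta_{ij}$. *)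

(* Defs.v *)
From HB Require Import structures.
From mathcomp Require Import all_boot all_order all_algebra.
From mathcomp Require Import all_classical all_reals all_analysis.

Set Implicit Arguments.
Unset Strict Implicit.
Unset Printing Implicit Defensive.

Import Order.TTheory GRing.Theory Num.Theory.
Import numFieldNormedType.Exports.

Local Open Scope classical_set_scope.
Local Open Scope ring_scope.

(* Tensor indices 1, 2 are the elements 0, 1 of 'I_2. *)

(** Geometry of the element map *)

Definition ref_square (R : realType) : set 'rV[R]_2 :=
  [set p | forall k, p 0 k \in `[-1, 1]].

Definition partialD (R : realType) (V : normedModType R) (k : 'I_2)
    (F : 'rV[R]_2 -> V) (p : 'rV[R]_2) : V :=
  'D_(delta_mx 0 k) F p.

(* Smoothness up to the boundary of A: F is C^oo on an open neighbourhood
   of A, i.e. all its iterated partial derivatives are differentiable there. *)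
Definition smooth_near (R : realType) (V : normedModType R)
    (A : set 'rV[R]_2) (F : 'rV[R]_2 -> V) : Prop :=
  exists U : set 'rV[R]_2, [/\ open U, A `<=` U &
    forall (s : seq 'I_2) p, U p ->
      differentiable (foldr (@partialD R V) F s) p].

Definition sym_posdef (R : realType) n (G : 'M[R]_n) : Prop :=
  G^T = G /\ forall z : 'rV[R]_n, z != 0 -> 0 < (z *m G *m z^T) 0 0.

Definition metric_mx (R : realType) (X : 'rV[R]_2 -> 'rV[R]_3) (p : 'rV[R]_2) :
    'M[R]_2 :=
  \matrix_(i, j) (partialD i X p *m (partialD j X p)^T) 0 0.

Definition areaJ (R : realType) (G : 'M[R]_2) : R := Num.sqrt (\det G).

(* [christoffel X p i j k] is \Gamma^i_{jk}. *)
Definition christoffel (R : realType) (X : 'rV[R]_2 -> 'rV[R]_3)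
    (p : 'rV[R]_2) (i j k : 'I_2) : R :=
  2^-1 * \sum_l invmx (metric_mx X p) i l *
    (partialD j (fun q => metric_mx X q k l : R^o) p
     + partialD k (fun q => metric_mx X q j l : R^o) p
     - partialD l (fun q => metric_mx X q j k : R^o) p).

Definition levi_civita (R : realType) (j k : 'I_2) : R :=
  (j < k)%N%:R - (k < j)%N%:R.

(** Shallow water state u = (h, hv^1, hv^2)^T, entropy and source term *)

Definition depth (R : realType) (u : 'cV[R]_3) : R := u 0 0.

Definition momentum (R : realType) (u : 'cV[R]_3) (i : 'I_2) : R :=
  u (lift ord0 i) 0.

Definition vcon (R : realType) (u : 'cV[R]_3) (i : 'I_2) : R :=
  momentum u i / depth u.

Definition vcov (R : realType) (G : 'M[R]_2) (u : 'cV[R]_3) (i : 'I_2) : R :=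
  \sum_j G i j * vcon u j.

(* The data (u, G, b) at a point, on which the numerical fluxes depend. *)
Record pt_data (R : realType) := PtData {
  pt_state : 'cV[R]_3;
  pt_metric : 'M[R]_2;
  pt_bottom : R }.

Definition sw_entropy (R : realType) (g : R) (G : 'M[R]_2) (b : R)
    (u : 'cV[R]_3) : R :=
  2^-1 * depth u * (\sum_i vcov G u i * vcon u i)
  + 2^-1 * g * depth u ^+ 2 + g * depth u * b.

(* w = \partial \eta / \partial u, with G and b held fixed. *)
Definition sw_entropy_vars (R : realType) (g : R) (z : pt_data R) : 'cV[R]_3 :=
  \col_k 'D_(delta_mx k 0) (sw_entropy g (pt_metric z) (pt_bottom z) : _ -> R^o) (pt_state z).

(* J \Psi^j *)
Definition jflux_potential (R : realType) (g : R) (z : pt_data R) (j : 'I_2) :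
    R :=
  areaJ (pt_metric z) * (2^-1 * g * depth (pt_state z) ^+ 2 * vcon (pt_state z) j).

Definition source_mom (R : realType) (X : 'rV[R]_2 -> 'rV[R]_3)
    (f : 'rV[R]_2 -> R) (p : 'rV[R]_2) (u : 'cV[R]_3) (i : 'I_2) : R :=
  let G := metric_mx X p in
  let Gamma := christoffel X p in
  - 2^-1 *
    (\sum_j \sum_k Gamma i j k * depth u * vcon u j * vcon u k
     - \sum_j \sum_k \sum_l
         invmx G i k * Gamma l j k * depth u * vcon u j * vcov G u l)
  - f p * areaJ G *
    \sum_j \sum_k invmx G i j * levi_civita R j k * momentum u k.

Definition sw_source (R : realType) (X : 'rV[R]_2 -> 'rV[R]_3)
    (f : 'rV[R]_2 -> R) (p : 'rV[R]_2) (u : 'cV[R]_3) : 'cV[R]_3 :=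
  \col_k oapp (source_mom X f p u) 0 (unlift ord0 k).

(** Legendre-Gauss-Lobatto collocation *)

(* Rodrigues' formula *)
Definition legendre (R : realType) (n : nat) : {poly R} :=
  (2 ^+ n * n`!%:R)^-1 *: (('X ^+ 2 - 1) ^+ n)^`(n).

(* The N + 1 zeros of (1 - x^2) P_N'(x), in increasing order (0 < N). *)
Definition lgl_nodes (R : realType) (N : nat) (xi : 'I_N.+1 -> R) : Prop :=
  (forall i j : 'I_N.+1, (i < j)%N -> xi i < xi j) /\
  (forall i, root ((1 - 'X ^+ 2) * (legendre R N)^`()) (xi i)).

(* qpoly's lagrange basis is not used: its theory needs nodes indexed by all
   of nat. *)
Definition lagrange_poly (R : realType) (N : nat) (xi : 'I_N.+1 -> R)
    (i : 'I_N.+1) : {poly R} :=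
  \prod_(j | j != i) ((xi i - xi j)^-1 *: ('X - (xi j)%:P)).

(* Weights of the interpolatory quadrature rule on the nodes xi. *)
Definition lgl_weight (R : realType) (N : nat) (xi : 'I_N.+1 -> R) (i : 'I_N.+1) :
    R :=
  \int[lebesgue_measure]_(x in `[-1, 1]) (lagrange_poly xi i).[x].

Definition collocD (R : realType) (N : nat) (xi : 'I_N.+1 -> R) : 'M[R]_N.+1 :=
  \matrix_(i, j) ((lagrange_poly xi j)^`()).[xi i].

Definition collocM (R : realType) (N : nat) (xi : 'I_N.+1 -> R) : 'M[R]_N.+1 :=
  diag_mx (\row_i lgl_weight xi i).

Definition collocQ (R : realType) (N : nat) (xi : 'I_N.+1 -> R) : 'M[R]_N.+1 :=
  collocM xi *m collocD xi.

Definition collocB (R : realType) (N : nat) : 'M[R]_N.+1 :=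
  diag_mx (\row_i ((i == ord_max)%:R - (i == ord0)%:R)).

Definition collocS (R : realType) (N : nat) (xi : 'I_N.+1 -> R) : 'M[R]_N.+1 :=
  2 *: collocQ xi - collocB R N.

Definition gridpt (R : realType) (N : nat) (xi : 'I_N.+1 -> R)
    (i j : 'I_N.+1) : 'rV[R]_2 :=
  \row_k (if k == 0 then xi i else xi j).

(* The sides xi^1 = -1, xi^1 = 1, xi^2 = -1, xi^2 = 1 of the square. A corner
   node lies on two sides and has one external state for each of them. External
   states are expressed in the coordinate system of the interior node. *)
Variant side := West | East | South | North.

(** Numerical fluxes and entropy production. [flux k L R] is (J f^k)_{L,R},
    with no symmetry in (L, R). *)

Definition num_flux (R : realType) :=
  'I_2 -> pt_data R -> pt_data R -> 'cV[R]_3.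

Definition dotc (R : realType) n (w f : 'cV[R]_n) : R := (w^T *m f) 0 0.

Definition entropy_flux (R : realType) (g : R) (flux : num_flux R) (k : 'I_2)
    (zL zR : pt_data R) : R :=
  2^-1 * (dotc (sw_entropy_vars g zL) (flux k zL zR)
          + dotc (sw_entropy_vars g zR) (flux k zR zL))
  - 2^-1 * (jflux_potential g zL k + jflux_potential g zR k).

Definition entropy_prod (R : realType) (g : R) (flux : num_flux R) (k : 'I_2)
    (zL zR : pt_data R) : R :=
  (dotc (sw_entropy_vars g zR) (flux k zR zL)
   - dotc (sw_entropy_vars g zL) (flux k zL zR))
  - (jflux_potential g zR k - jflux_potential g zL k).

(* Main.v *)
Require Import Defs.
From HB Require Import structures.
From mathcomp Require Import all_boot all_order all_algebra.
From mathcomp Require Import all_classical all_reals all_analysis.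
From mathcomp Require Import zify ring lra.
From mathcomp Require cauchyreals polyorder.
Import Order.TTheory GRing.Theory Num.Theory.
Import numFieldNormedType.Exports.
Local Open Scope classical_set_scope.
Local Open Scope ring_scope.

Set Implicit Arguments.
Unset Strict Implicit.
Unset Printing Implicit Defensive.

(** At each node the scheme prescribes the rate of the state, and pairing it
    with the entropy variables w gives the rate of the nodal entropy.  Summing
    over the nodes with their quadrature weights gives the claim for three
    reasons.

    - Chain rule.  The kinetic energy is a quadratic form of the momentum
      divided by the depth, so the entropy is differentiable where the depth
      does not vanish, and its
      derivative along any curve is the pairing of w with the derivative of the
      curve ([is_derive_sw_entropy], [dotc_entropy_vars]).  The source does no
      work ([sw_source_orthogonal]): its two Christoffel terms cancel once
      the index of the velocity is raised, and the Coriolis force is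
      perpendicular to the velocity.

    - Summation by parts.  The collocation matrices satisfy D 1 = 0 and
      Q + Q^T = B ([collocD_sum_row], [collocQ_sbp]), so S = Q - Q^T, and the
      sum of S against w_L^T f_(L,R) is the sum of Q against the jumps
      w_R^T f_(R,L) - w_L^T f_(L,R).  These jumps are the entropy productions
      up to the jumps of the flux potential, which the same two identities
      telescope to the endpoints of the line ([flux_difference_line]).

    - Surface terms.  There the interior half w_in^T f^*_(in,ext), minus the
      interior potential, is the numerical entropy flux plus or minus half the
      entropy production, the external halves cancelling
      ([surface_term_inflow], [surface_term_outflow]).

    The line identity [line_balance] combines the last two facts; it is used
    along each grid line of either direction.

    The identity Q + Q^T = B is the fundamental theorem of calculus for the
    product of two Lagrange polynomials, provided that the quadrature is exact
    on its derivative and that the first and last nodes are -1 and 1.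
    Exactness up to degree 2N - 1 ([lgl_quadrature_exact]) follows from
    division by the nodal polynomial (1 - x^2) P_N' and from the orthogonality
    of P_N to lower degrees.  The endpoints, and the fact that all nodes lie in
    the reference square, where the metric is positive definite, come from the
    bound |x| <= 1 on the roots of P_N' ([root_legendre_deriv_le1]). *)

(** * Integrals of polynomials and Legendre orthogonality *)

Definition poly_int (R : realType) (p : {poly R}) : R :=
  \int[lebesgue_measure]_(x in `[-1, 1]) p.[x].

(** Since every polynomial is a derivative, this formula determines [poly_int];
    linearity and integration by parts are read off from it without any
    integrability argument. *)
Lemma poly_int_deriv (R : realType) (p : {poly R}) :
  poly_int p^`() = p.[1] - p.[-1].
Proof.
have lt_N11 : -1 < 1 :> R by lra.
rewrite /poly_int /Rintegral.
rewrite (@continuous_FTC2 R (horner p^`()) (horner p) (-1) 1 lt_N11) //.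
- exact/continuous_subspaceT/continuous_horner.
- split=> [x _||].
  + exact: derivable_horner.
  + exact/cvg_at_right_filter/continuous_horner.
  + exact/cvg_at_left_filter/continuous_horner.
- by move=> x _; rewrite derivE.
Qed.

Definition antideriv (R : realType) (p : {poly R}) : {poly R} :=
  \poly_(i < (size p).+1) (p`_i.-1 / i%:R).

Lemma antiderivK (R : realType) (p : {poly R}) : (antideriv p)^`() = p.
Proof.
apply/polyP=> i; rewrite coef_deriv coef_poly /= ltnS.
case: ltnP => [_|le_pi]; last by rewrite mul0rn nth_default.
by rewrite -[LHS]mulr_natr divfK // pnatr_eq0.
Qed.

Lemma poly_intZD (R : realType) (a : R) (p q : {poly R}) :
  poly_int (a *: p + q) = a * poly_int p + poly_int q.
Proof.
rewrite -[p]antiderivK -[q]antiderivK -derivZ -derivD !poly_int_deriv.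
by rewrite !hornerD !hornerZ; ring.
Qed.

Lemma poly_int_is_zmod_morphism (R : realType) : zmod_morphism (@poly_int R).
Proof.
by move=> p q; rewrite addrC -scaleN1r poly_intZD mulN1r addrC.
Qed.

HB.instance Definition _ (R : realType) :=
  GRing.isZmodMorphism.Build {poly R} R (@poly_int R)
    (@poly_int_is_zmod_morphism R).

Lemma poly_intZ (R : realType) (a : R) (p : {poly R}) :
  poly_int (a *: p) = a * poly_int p.
Proof. by rewrite -[a *: p]addr0 poly_intZD raddf0 addr0. Qed.

Lemma poly_int_by_parts (R : realType) (p q : {poly R}) :
  p.[1] * q.[1] = 0 -> p.[-1] * q.[-1] = 0 ->
  poly_int (p * q^`()) = - poly_int (p^`() * q).
Proof.
move=> pq1 pqN1; apply/eqP; rewrite eq_sym -subr_eq0 -opprD oppr_eq0.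
by rewrite -raddfD /= -derivM poly_int_deriv !hornerM pq1 pqN1 subrr.
Qed.

(** Each derivative lowers the multiplicity of a root by at most one; the
    cofactor q makes the induction on k go through. *)
Lemma root_derivn_exp (R : realType) (p q : {poly R}) (n k : nat) (x : R) :
  (k < n)%N -> root p x -> root (p ^+ n * q)^`(k) x.
Proof.
move=> lt_kn px0; elim: k n q lt_kn => [|k IHk] [//|n] q lt_kn.
  by rewrite derivn0 exprS -mulrA rootM px0.
rewrite derivSn derivM deriv_exp /=.
have -> : p^`() * p ^+ n *+ n.+1 * q + p ^+ n.+1 * q^`() =
    p ^+ n * (p^`() * q *+ n.+1 + p * q^`()) by rewrite exprS; ring.
exact: IHk.
Qed.

(** The polynomial that Rodrigues' formula differentiates. *)
Definition legendre_core (R : realType) (n : nat) : {poly R} := ('X ^+ 2 - 1) ^+ n.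

Lemma legendreE (R : realType) (n : nat) :
  legendre R n = (2 ^+ n * n`!%:R)^-1 *: (legendre_core R n)^`(n).
Proof. by []. Qed.

Lemma legendre_scale_neq0 (R : realType) (n : nat) :
  (2 ^+ n * n`!%:R)^-1 != 0 :> R.
Proof.
by rewrite invr_neq0 // mulf_neq0 ?expf_neq0 ?pnatr_eq0 // -lt0n fact_gt0.
Qed.

Lemma root_derivn_legendre_core (R : realType) (n k : nat) (x : R) :
  (k < n)%N -> x ^+ 2 = 1 -> root (legendre_core R n)^`(k) x.
Proof.
move=> lt_kn x21; rewrite -[legendre_core R n]mulr1 root_derivn_exp //.
by rewrite /root !hornerE x21 subrr.
Qed.

(** Integrating by parts moves the n derivatives of Rodrigues' formula onto q one
    at a time.  No boundary term appears, since fewer than n derivatives of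
    (x^2 - 1)^n vanish at both endpoints, and q has been differentiated away by
    the end. *)
Lemma legendre_orthogonal (R : realType) (n : nat) (q : {poly R}) :
  (size q <= n)%N -> poly_int (q * legendre R n) = 0.
Proof.
move=> size_q; rewrite legendreE -scalerAr poly_intZ.
suff H k (p : {poly R}) : (k <= n)%N -> (size p <= k)%N ->
    poly_int (p * (legendre_core R n)^`(k)) = 0.
  by rewrite H ?mulr0.
elim: k p => [|k IHk] p le_kn size_p.
  by move: size_p; rewrite leqn0 size_poly_eq0 => /eqP->; rewrite mul0r raddf0.
rewrite derivnS poly_int_by_parts.
- rewrite (IHk _ (ltnW le_kn)) ?oppr0 //.
  have [->|p0] := eqVneq p 0; first by rewrite deriv0 size_poly0.
  by rewrite -ltnS (leq_trans (lt_size_deriv p0)).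
- by rewrite (rootP (root_derivn_legendre_core le_kn _)) ?expr1n ?mulr0.
- by rewrite (rootP (root_derivn_legendre_core le_kn _)) ?sqrrN ?expr1n ?mulr0.
Qed.

(** * Location of the nodes *)

Lemma size_legendre_core (R : realType) (n : nat) :
  size (legendre_core R n) = (n.*2).+1.
Proof.
have size1 : size ('X ^+ 2 - 1 : {poly R}) = 3.
  by rewrite size_XnsubC.
have nz : legendre_core R n != 0.
  by rewrite expf_neq0 // -size_poly_eq0 size1.
have := size_exp ('X ^+ 2 - 1 : {poly R}) n; rewrite size1 /= mul2n => <-.
by rewrite prednK // size_poly_gt0.
Qed.

Lemma derivn_comp_affine (R : comNzRingType) (p : {poly R}) (a c : R) (k : nat) :
  (p \Po (a *: 'X + c%:P))^`(k) = a ^+ k *: (p^`(k) \Po (a *: 'X + c%:P)).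
Proof.
elim: k => [|k IHk]; first by rewrite !derivn0 expr0 scale1r.
rewrite derivnS IHk derivZ deriv_comp derivnS derivD derivZ derivX derivC addr0.
by rewrite -scalerAr mulr1 scalerA -exprSr.
Qed.

Lemma horner_polyOver_nneg_gt0 (R : realDomainType) (p : {poly R}) (y : R) :
  p \is a polyOver Num.nneg -> p != 0 -> 0 < y -> 0 < p.[y].
Proof.
move=> /polyOverP p_ge0 p0 y0.
have term_ge0 i : 0 <= p`_i * y ^+ i.
  by rewrite mulr_ge0 ?exprn_ge0 ?(ltW y0) //; have := p_ge0 i; rewrite nnegrE.
have size_p : (size p).-1.+1 = size p by rewrite prednK // size_poly_gt0.
rewrite horner_coef -size_p big_ord_recr /= ltr_wpDl ?sumr_ge0 //.
have yk : y ^+ (size p).-1 != 0 by rewrite expf_neq0 ?gt_eqF.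
by rewrite lt_def term_ge0 andbT mulf_neq0 // -lead_coefE lead_coef_eq0.
Qed.

(** The change of variable x = s (y + 1), with s the sign of x, turns
    (x^2 - 1)^n into (y^2 + 2y)^n, whose derivative of order n + 1 is nonzero
    with nonnegative coefficients and so has no root y > 0.  A root with
    |x| > 1 would be at y = |x| - 1 > 0. *)
Lemma root_legendre_deriv_le1 (R : realType) (n : nat) (x : R) :
  (0 < n)%N -> root (legendre R n)^`() x -> `|x| <= 1.
Proof.
move=> n0; rewrite legendreE derivZ -derivnS rootZ ?legendre_scale_neq0 // => rx.
rewrite leNgt; apply/negP => x_gt1.
pose s := Num.sg x; pose q : {poly R} := s *: 'X + s%:P.
have x0 : x != 0 by rewrite -normr_gt0 (lt_trans _ x_gt1).
have ss : s * s = 1 by rewrite -expr2 sqr_sg x0.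
have q_at : q.[`|x| - 1] = x.
  by rewrite !hornerE mulrBr mulr1 subrK -numEsg.
have coreq : legendre_core R n \Po q = ('X ^+ 2 + 'X *+ 2) ^+ n.
  rewrite /legendre_core rmorphXn rmorphB rmorphXn /= comp_polyX comp_polyC.
  congr (_ ^+ n); rewrite /q -!mul_polyC.
  have -> : (s%:P * 'X + s%:P) ^+ 2 = (s * s)%:P * ('X + 1) ^+ 2 :> {poly R}.
    by rewrite polyCM; ring.
  by rewrite ss; ring.
have nneg : (legendre_core R n \Po q)^`(n.+1) \is a polyOver Num.nneg.
  have X_nneg : ('X : {poly R}) \is a polyOver Num.nneg by exact: polyOverX.
  rewrite coreq; apply/polyOver_derivn/rpredX.
  by apply: rpredD; [exact: rpredX | exact: rpredMn].
have size_q : size q = 2.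
  rewrite size_polyDl size_scale ?sgr_eq0 ?size_polyX //.
  by rewrite size_polyC; case: (s != 0).
have nz : (legendre_core R n \Po q)^`(n.+1) != 0.
  rewrite -size_poly_eq0 cauchyreals.size_derivn size_comp_poly2 //.
  rewrite size_legendre_core; move: n0; lia.
have := horner_polyOver_nneg_gt0 nneg nz (_ : 0 < `|x| - 1).
rewrite derivn_comp_affine hornerZ horner_comp q_at (rootP rx) mulr0 ltxx subr_gt0.
by move/(_ x_gt1).
Qed.

Definition lgl_poly (R : realType) (n : nat) : {poly R} :=
  (1 - 'X ^+ 2) * (legendre R n)^`().

Lemma size_1subX2 (R : realType) : size (1 - 'X ^+ 2 : {poly R}) = 3.
Proof. by rewrite -size_polyN opprB size_XnsubC. Qed.

Lemma size_lgl_poly (R : realType) (n : nat) :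
  (0 < n)%N -> size (lgl_poly R n) = n.+2.
Proof.
move=> n0.
have size2 : size (legendre R n)^`() = n.
  rewrite legendreE derivZ -derivnS size_scale ?legendre_scale_neq0 //.
  by rewrite cauchyreals.size_derivn size_legendre_core -addnn subSS addnK.
rewrite size_mul ?size_1subX2 ?size2 //; first by rewrite -size_poly_eq0 size_1subX2.
by rewrite -size_poly_eq0 size2 -lt0n.
Qed.

Section LGL.
Variables (R : realType) (N : nat) (xi : 'I_N.+1 -> R).
Hypotheses (N_gt0 : (0 < N)%N) (xi_lgl : lgl_nodes xi).

Lemma lgl_nodes_inj : injective xi.
Proof.
have [xi_lt _] := xi_lgl.
move=> i j eq_ij.
have [/xi_lt|/xi_lt|/ord_inj //] := ltngtP i j; by rewrite eq_ij ltxx.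
Qed.

Lemma lgl_nodes_itv i : -1 <= xi i <= 1.
Proof.
have [_ /(_ i)] := xi_lgl; rewrite rootM => /orP[|/root_legendre_deriv_le1].
  rewrite /root !hornerE subr_eq0 eq_sym sqrf_eq1 => /orP[]/eqP->; lra.
by rewrite ler_norml; apply.
Qed.

(** The N + 1 distinct nodes use up the degree of the nodal polynomial. *)
Lemma lgl_nodes_exhaust x : root (lgl_poly R N) x -> exists i, xi i = x.
Proof.
move=> rx; apply: contrapT => no_i.
have [_ xi_root] := xi_lgl.
have /eqP : lgl_poly R N = 0.
  apply: (@roots_geq_poly_eq0 _ _ (x :: [seq xi i | i <- enum 'I_N.+1])).
  - rewrite /= rx; apply/allP => _ /mapP[i _ ->]; exact: xi_root.
  - rewrite /= map_inj_uniq ?enum_uniq ?andbT; last exact: lgl_nodes_inj.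
    by apply/mapP => -[i _ xE]; apply: no_i; exists i.
  - by rewrite size_lgl_poly //= size_map size_enum_ord.
by rewrite -size_poly_eq0 size_lgl_poly.
Qed.

(** The endpoint is a root of the nodal polynomial, hence a node, and no node
    lies to its left. *)
Lemma lgl_node_first : xi ord0 = -1.
Proof.
have [i xi_i] : exists i, xi i = -1.
  by apply: lgl_nodes_exhaust; rewrite rootM /root !hornerE sqrrN expr1n subrr eqxx.
have [xi_lt _] := xi_lgl.
have [<- //|i0] := eqVneq i ord0.
have /xi_lt : (@ord0 N < i)%N by rewrite lt0n.
by have := lgl_nodes_itv ord0; rewrite xi_i; lra.
Qed.

Lemma lgl_node_last : xi ord_max = 1.
Proof.
have [i xi_i] : exists i, xi i = 1.
  by apply: lgl_nodes_exhaust; rewrite rootM /root !hornerE expr1n subrr eqxx.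
have [xi_lt _] := xi_lgl.
have [<- //|iN] := eqVneq i ord_max.
have /xi_lt : (i < @ord_max N)%N by rewrite ltn_neqAle leq_ord andbT.
by have := lgl_nodes_itv ord_max; rewrite xi_i; lra.
Qed.

Lemma size_lagrange_poly i : (size (lagrange_poly xi i) <= N.+1)%N.
Proof.
rewrite (leq_trans (size_prod_leq _ _)) //.
have card_neq : #|[pred j | j != i]| = N by rewrite (cardC1 i) card_ord.
have : (\sum_(j | j != i) size ((xi i - xi j)^-1 *: ('X - (xi j)%:P)) <=
        \sum_(j | j != i) 2)%N.
  by apply: leq_sum => j _; rewrite (leq_trans (size_scale_leq _ _)) ?size_XsubC.
rewrite sum_nat_const card_neq; move: (\sum_(j | _) _)%N => s; lia.
Qed.

Lemma lagrange_poly_node i j : (lagrange_poly xi i).[xi j] = (i == j)%:R.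
Proof.
rewrite horner_prod; have [<-|ij] := eqVneq i j.
  rewrite big1 // => k ki; rewrite !hornerE mulVf // subr_eq0.
  by rewrite (inj_eq lgl_nodes_inj) eq_sym.
by rewrite (bigD1 j) 1?eq_sym //= !hornerE subrr mulr0 mul0r.
Qed.

Lemma lagrange_interpolation (p : {poly R}) :
  (size p <= N.+1)%N -> p = \sum_k p.[xi k] *: lagrange_poly xi k.
Proof.
move=> size_p; apply/eqP; rewrite -subr_eq0; apply/eqP.
apply: (@roots_geq_poly_eq0 _ _ [seq xi i | i <- enum 'I_N.+1]).
- apply/allP => _ /mapP[i _ ->]; rewrite /root hornerD hornerN horner_sum subr_eq0.
  rewrite (bigD1 i) //= hornerZ lagrange_poly_node eqxx mulr1 big1 ?addr0 // => k ki.
  by rewrite hornerZ lagrange_poly_node (negPf ki) mulr0.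
- by rewrite map_inj_uniq ?enum_uniq //; exact: lgl_nodes_inj.
- rewrite size_map size_enum_ord (leq_trans (size_polyD _ _)) // geq_max size_p.
  rewrite size_polyN.
  apply: (leq_trans (size_sum _ _ _)); apply/bigmax_leqP => k _.
  exact: leq_trans (size_scale_leq _ _) (size_lagrange_poly k).
Qed.

(** Modulo the nodal polynomial, p is replaced by its interpolant r, which the
    rule integrates exactly by construction of the weights.  The discarded
    part q (1 - x^2) P_N' has integral zero: integrating by parts leaves P_N
    against a polynomial of degree less than N. *)
Lemma lgl_quadrature_exact (p : {poly R}) :
  (size p <= N.*2)%N -> \sum_k lgl_weight xi k * p.[xi k] = poly_int p.
Proof.
move=> size_p; have [_ xi_root] := xi_lgl.
have nz : lgl_poly R N != 0 by rewrite -size_poly_eq0 size_lgl_poly.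
set r := p %% lgl_poly R N; set q := p %/ lgl_poly R N.
have size_r : (size r <= N.+1)%N.
  by rewrite -ltnS -(size_lgl_poly R N_gt0) ltn_modpN0.
have size_q : (size q <= N.-1)%N.
  rewrite size_divp // size_lgl_poly //= leq_subLR (leq_trans size_p) //.
  by rewrite addSn -addnS prednK // addnn.
have pE : p = q * lgl_poly R N + r := divp_eq p _.
have -> : \sum_k lgl_weight xi k * p.[xi k] = poly_int r.
  rewrite [in RHS](lagrange_interpolation size_r) raddf_sum.
  apply: eq_bigr => k _; rewrite /= poly_intZ [LHS]mulrC pE.
  by rewrite hornerD hornerM (rootP (xi_root k)) mulr0 add0r.
rewrite [in RHS]pE raddfD /= /lgl_poly mulrA poly_int_by_parts.
- rewrite legendre_orthogonal ?oppr0 ?add0r //.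
  have [->|q0] := eqVneq q 0; first by rewrite mul0r deriv0 size_poly0.
  rewrite polyorder.size_deriv size_mul ?size_1subX2 //; last first.
    by rewrite -size_poly_eq0 size_1subX2.
  by rewrite addn3 /= -(prednK N_gt0) ltnS.
- have bnd : (1 - 'X ^+ 2 : {poly R}).[1] = 0 by rewrite !hornerE expr1n subrr.
  by rewrite hornerM bnd mulr0 mul0r.
- have bnd : (1 - 'X ^+ 2 : {poly R}).[-1] = 0.
    by rewrite !hornerE sqrrN expr1n subrr.
  by rewrite hornerM bnd mulr0 mul0r.
Qed.

Lemma collocQE i j : collocQ xi i j = lgl_weight xi i * collocD xi i j.
Proof. by rewrite /collocQ /collocM mul_diag_mx !mxE. Qed.

(** The Lagrange polynomials sum to the constant 1. *)
Lemma collocD_sum_row i : \sum_m collocD xi i m = 0.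
Proof.
have sum1 : 1 = \sum_m lagrange_poly xi m.
  rewrite [LHS]lagrange_interpolation ?size_poly1 //.
  by apply: eq_bigr => m _; rewrite hornerC scale1r.
under eq_bigr do rewrite mxE.
by rewrite -horner_sum -raddf_sum -sum1 /= derivC horner0.
Qed.

(** The two terms are the quadrature of the derivative of l_i l_j, of degree at
    most 2N - 1, hence equal to its integral, the boundary values of l_i l_j. *)
Lemma collocQ_sbp i j : collocQ xi i j + collocQ xi j i = collocB R N i j.
Proof.
have quad : \sum_k lgl_weight xi k *
      (lagrange_poly xi i * lagrange_poly xi j)^`().[xi k] =
    collocQ xi i j + collocQ xi j i.
  under eq_bigr do rewrite derivM hornerD !hornerM !lagrange_poly_node mulrDr.
  rewrite big_split /= addrC (bigD1 i) //= big1 ?addr0; last first.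
    by move=> k ki; rewrite eq_sym (negPf ki) mul0r mulr0.
  rewrite (bigD1 j) //= big1 ?addr0; last first.
    by move=> k kj; rewrite eq_sym (negPf kj) !mulr0.
  by rewrite !eqxx mul1r mulr1 !collocQE !mxE.
rewrite -quad lgl_quadrature_exact; last first.
  have [-> | nz] := eqVneq (lagrange_poly xi i * lagrange_poly xi j) 0.
    by rewrite deriv0 size_poly0.
  rewrite polyorder.size_deriv.
  have := size_polyMleq (lagrange_poly xi i) (lagrange_poly xi j).
  move: (size_lagrange_poly i) (size_lagrange_poly j).
  by move: (size _) (size _) (size _); lia.
rewrite poly_int_deriv -lgl_node_first -lgl_node_last !hornerM !lagrange_poly_node.
rewrite !mxE.
have [<-|ij] := eqVneq i j.
  by rewrite mulr1n -!natrM !mulnb !andbb.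
have not_both k : (i == k) && (j == k) = false.
  by apply/andP => -[/eqP ik /eqP jk]; rewrite ik jk eqxx in ij.
by rewrite mulr0n -!natrM !mulnb !not_both subrr.
Qed.

End LGL.

(** * Entropy variables *)

(** The differential of the entropy at u applied to du.  The metric is
    symmetrized because the formula is used for an arbitrary matrix G. *)
Definition sw_entropy_diff (R : realType) (g : R) (G : 'M[R]_2) (b : R)
    (u du : 'cV[R]_3) : R :=
  (g * (depth u + b)
    - 2^-1 * \sum_i \sum_j G i j * vcon u i * vcon u j) * depth du
  + 2^-1 * \sum_i \sum_j (G i j + G j i) * vcon u j * momentum du i.

Lemma sum_tensor (V : nmodType) (F : 'I_2 -> V) : \sum_i F i = F 0 + F 1.
Proof.
rewrite big_ord_recl big_ord_recl big_ord0 addr0; congr (_ + F _).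
exact/val_inj.
Qed.

Lemma is_derive_coord (R : realType) (V : normedModType R) (n : nat)
    (c : V -> 'cV[R]_n) (x v : V) (dc : 'cV[R]_n) (k : 'I_n) :
  is_derive x v c dc -> is_derive x v (fun y => c y k 0) (dc k 0).
Proof.
move=> [c_diff <-]; split; first exact: ((derivable_mxP _ _ _).1 c_diff).
by rewrite derive_mx // mxE.
Qed.

(** The entropy written with 1/h as a separate factor: kinetic energy is a
    quadratic form of the momentum over h.  The depth and momentum are abstract
    functions so that the product and quotient rules apply directly. *)
Lemma is_derive_energy (R : realType) (V : normedModType R) (x v : V)
    (a00 a01 a11 e2 e1 : R) (h m0 m1 : V -> R) (dh dm0 dm1 : R) :
  h x != 0 -> is_derive x v h dh -> is_derive x v m0 dm0 ->
  is_derive x v m1 dm1 ->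
  is_derive x v
    (fun y => (h y)^-1 * (a00 * m0 y ^+ 2 + a01 * (m0 y * m1 y)
                          + a11 * m1 y ^+ 2) + e2 * h y ^+ 2 + e1 * h y : R)
    (- (h x) ^- 2 * dh * (a00 * m0 x ^+ 2 + a01 * (m0 x * m1 x)
                          + a11 * m1 x ^+ 2)
     + (h x)^-1 * (a00 * (2 * m0 x * dm0) + a01 * (m0 x * dm1 + m1 x * dm0)
                   + a11 * (2 * m1 x * dm1))
     + e2 * (2 * h x * dh) + e1 * dh).
Proof.
move=> h_neq0 Dh Dm0 Dm1.
pose k y := (h y)^-1.
have Dk : is_derive x v k (- (h x) ^- 2 * dh).
  split; first by apply: derivableV => //; case: Dh.
  by rewrite deriveV // derive_val.
have kx : k x = (h x)^-1 by [].
rewrite -kx; have -> : (fun y => (h y)^-1 * (a00 * m0 y ^+ 2 + a01 * (m0 y * m1 y)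
      + a11 * m1 y ^+ 2) + e2 * h y ^+ 2 + e1 * h y : R) =
    k * (a00 *: (m0 * m0) + a01 *: (m0 * m1) + a11 *: (m1 * m1))
    + e2 *: (h * h) + e1 *: h.
  by apply/funext => y; rewrite /k !fctE.
have Dquad := is_deriveD (is_deriveD (is_deriveZ a00 (is_deriveM Dm0 Dm0))
  (is_deriveZ a01 (is_deriveM Dm0 Dm1))) (is_deriveZ a11 (is_deriveM Dm1 Dm1)).
have := is_deriveD (is_deriveD (is_deriveM Dk Dquad)
  (is_deriveZ e2 (is_deriveM Dh Dh))) (is_deriveZ e1 Dh).
move/is_derive_eq; apply; rewrite !fctE /GRing.scale /= /GRing.scale /=.
move: (- (h x) ^- 2) => k2; ring.
Qed.

(** A curve c in an arbitrary normed space of parameters serves two purposes: the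
    identity of state space gives the entropy variables, and the solution in
    time gives the chain rule. *)
Lemma is_derive_sw_entropy (R : realType) (g : R) (G : 'M[R]_2) (b : R)
    (V : normedModType R) (c : V -> 'cV[R]_3) (x v : V) (dc : 'cV[R]_3) :
  depth (c x) != 0 -> is_derive x v c dc ->
  is_derive x v (fun y => sw_entropy g G b (c y) : R^o)
    (sw_entropy_diff g G b (c x) dc).
Proof.
move=> h_neq0 dc_c.
have := @is_derive_energy R V x v (2^-1 * G 0 0) (2^-1 * (G 0 1 + G 1 0))
  (2^-1 * G 1 1) (2^-1 * g) (g * b) _ _ _ _ _ _ h_neq0
  (is_derive_coord ord0 dc_c) (is_derive_coord (lift ord0 0) dc_c)
  (is_derive_coord (lift ord0 1) dc_c).
set F := (X in is_derive _ _ X _); set F' := (X in _ -> is_derive _ _ X _).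
have -> : F = F'.
  apply/funext => y; rewrite /F /F' /sw_entropy /vcov !sum_tensor /vcon /momentum.
  rewrite -/(depth (c y)).
  (* At zero depth both formulas vanish, as the inverse of 0 is 0. *)
  have [->|hy] := eqVneq (depth (c y)) 0; first by rewrite invr0; ring.
  by field.
congr is_derive; rewrite /sw_entropy_diff !sum_tensor /vcon /momentum.
by rewrite -/(depth (c x)) -/(depth dc); field.
Qed.

Lemma dotcE (R : realType) n (w f : 'cV[R]_n) : dotc w f = \sum_k w k 0 * f k 0.
Proof. by rewrite /dotc mxE; apply: eq_bigr => k _; rewrite mxE. Qed.

Lemma dotc_entropy_vars (R : realType) (g : R) (z : pt_data R) (d : 'cV[R]_3) :
  depth (pt_state z) != 0 ->
  dotc (sw_entropy_vars g z) d =
  sw_entropy_diff g (pt_metric z) (pt_bottom z) (pt_state z) d.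
Proof.
move=> h_neq0; rewrite dotcE.
under eq_bigr => k _.
  rewrite mxE.
  have /@derive_val -> := is_derive_sw_entropy g (pt_metric z) (pt_bottom z) h_neq0
    (is_derive_id (pt_state z) (delta_mx k 0)).
  over.
rewrite !big_ord_recl big_ord0 /sw_entropy_diff !sum_tensor /depth /momentum !mxE /=.
have -> : lift ord0 (1 : 'I_2) = lift ord0 (lift ord0 ord0) :> 'I_3 by exact/val_inj.
ring.
Qed.

Lemma sym_posdef_unitmx (R : realType) n (G : 'M[R]_n) :
  sym_posdef G -> G \in unitmx.
Proof.
move=> [_ G_pos]; rewrite -row_free_unit -kermx_eq0.
apply/eqP/row_matrixP => i; rewrite row0.
apply/eqP/negPn/negP => /G_pos.
by rewrite -row_mul mulmx_ker row0 mul0mx mxE ltxx.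
Qed.

Lemma vcov_raise (R : realType) (G : 'M[R]_2) (u : 'cV[R]_3) (k : 'I_2) :
  sym_posdef G -> \sum_i vcov G u i * invmx G i k = vcon u k.
Proof.
move=> G_spd; have [G_sym _] := G_spd.
have : (\row_j vcon u j) *m G *m invmx G = \row_j vcon u j.
  by rewrite mulmxK ?sym_posdef_unitmx.
move/rowP/(_ k); rewrite mxE [RHS]mxE => <-; apply: eq_bigr => i _.
congr (_ * _); rewrite mxE; apply: eq_bigr => j _.
by rewrite mxE mulrC -[in LHS]G_sym mxE.
Qed.

(** With v^k = v_i G^(ik), the sum of v_i G^(ik) Gamma^l_(jk) h v^j v_l is the
    sum of v_l Gamma^l_(jk) h v^j v^k, so the two Christoffel terms cancel; the
    Coriolis term becomes h eps_(jk) v^j v^k, which is zero by antisymmetry. *)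
Lemma sw_source_orthogonal (R : realType) (g : R) (X : 'rV[R]_2 -> 'rV[R]_3)
    (b : R) (f : 'rV[R]_2 -> R) (p : 'rV[R]_2) (u : 'cV[R]_3) :
  sym_posdef (metric_mx X p) -> depth u != 0 ->
  dotc (sw_entropy_vars g (PtData u (metric_mx X p) b)) (sw_source X f p u) = 0.
Proof.
move=> G_spd h_neq0; rewrite dotc_entropy_vars //=.
have sE i : momentum (sw_source X f p u) i = source_mom X f p u i.
  by rewrite /momentum /sw_source mxE liftK.
have s0 : depth (sw_source X f p u) = 0.
  by rewrite /depth /sw_source mxE unlift_none.
have G10 : metric_mx X p 1 0 = metric_mx X p 0 1.
  by rewrite -[in LHS](proj1 G_spd) [LHS]mxE.
have -> : sw_entropy_diff g (metric_mx X p) b u (sw_source X f p u) =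
    \sum_i vcov (metric_mx X p) u i * source_mom X f p u i.
  by rewrite /sw_entropy_diff s0 /vcov !sum_tensor G10 !sE; field.
have mE k : momentum u k = depth u * vcon u k by rewrite /vcon mulrC divfK.
move: (vcov_raise u 0 G_spd) (vcov_raise u 1 G_spd).
rewrite /source_mom /levi_civita /=.
move: (christoffel X p) (invmx _) (areaJ _) (vcov _ u) => Gamma Ginv J v.
by rewrite !sum_tensor !mE /= => <- <-; ring.
Qed.

(** * Summation by parts and the energy balance *)

Lemma dotcD (R : realType) n (w f1 f2 : 'cV[R]_n) :
  dotc w (f1 + f2) = dotc w f1 + dotc w f2.
Proof. by rewrite /dotc mulmxDr mxE. Qed.

Lemma dotcN (R : realType) n (w f : 'cV[R]_n) : dotc w (- f) = - dotc w f.
Proof. by rewrite /dotc mulmxN mxE. Qed.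

Lemma dotcZ (R : realType) n (w : 'cV[R]_n) a f : dotc w (a *: f) = a * dotc w f.
Proof. by rewrite /dotc -scalemxAr mxE. Qed.

Lemma dotc_sum (R : realType) n m (w : 'cV[R]_n) (f : 'I_m -> 'cV[R]_n) :
  dotc w (\sum_i f i) = \sum_i dotc w (f i).
Proof. by rewrite /dotc mulmx_sumr summxE. Qed.

Lemma sum_delta (R : pzRingType) n (k : 'I_n) (F : 'I_n -> R) :
  \sum_i (i == k)%:R * F i = F k.
Proof.
rewrite (bigD1 k) //= eqxx mul1r big1 ?addr0 // => i /negPf->.
by rewrite mul0r.
Qed.

(** Skew-symmetry of S exchanges left and right states.  The potential psi can be
    inserted at the price of its boundary values, because Q annihilates
    constants on the right and reduces to B on the left. *)
Lemma flux_difference_line (R : realType) (N : nat) (xi : 'I_N.+1 -> R)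
    (a : 'I_N.+1 -> 'I_N.+1 -> R) (psi : 'I_N.+1 -> R) :
  (0 < N)%N -> lgl_nodes xi ->
  - \sum_i \sum_m collocS xi i m * a i m =
  psi ord_max - psi ord0
  + \sum_i \sum_m lgl_weight xi i *
      (collocD xi i m * (a m i - a i m - (psi m - psi i))).
Proof.
move=> N_gt0 xi_lgl; set Q := collocQ xi.
have SE i m : collocS xi i m = Q i m - Q m i.
  rewrite /collocS mxE [X in X + _]mxE [X in _ + X]mxE.
  by rewrite -(collocQ_sbp N_gt0 xi_lgl) -/Q; ring.
have Q_psi_row : \sum_i \sum_m Q i m * psi i = 0.
  apply: big1 => i _; under eq_bigr do rewrite /Q collocQE mulrAC.
  by rewrite -mulr_sumr (collocD_sum_row N_gt0 xi_lgl) mulr0.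
have Q_psi_col : \sum_i \sum_m Q i m * psi m = psi ord_max - psi ord0.
  have <- : \sum_i \sum_m collocB R N i m * psi m = psi ord_max - psi ord0.
    rewrite -(sum_delta ord_max) -(sum_delta ord0) -sumrB.
    apply: eq_bigr => i _; rewrite (bigD1 i) //= big1 ?addr0 => [|m mi].
      by rewrite !mxE eqxx mulr1n; ring.
    by rewrite !mxE [i == m]eq_sym (negPf mi) mulr0n mul0r.
  have Q_psi_tr : \sum_i \sum_m Q m i * psi m = 0 by rewrite exchange_big.
  rewrite -[LHS]addr0 -[X in _ + X]Q_psi_tr -big_split /=.
  apply: eq_bigr => i _; rewrite -big_split /=; apply: eq_bigr => m _.
  by rewrite -(collocQ_sbp N_gt0 xi_lgl) mulrDl.
have Q_a : \sum_i \sum_m Q m i * a i m = \sum_i \sum_m Q i m * a m i.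
  by rewrite exchange_big.
transitivity (\sum_i \sum_m Q i m * a m i - \sum_i \sum_m Q i m * a i m).
  rewrite -Q_a -sumrB -sumrN; apply: eq_bigr => i _.
  rewrite -sumrB -sumrN; apply: eq_bigr => m _; rewrite SE; ring.
rewrite -Q_psi_col -[LHS]addr0 -[X in _ + X = _]Q_psi_row -!sumrB -!big_split /=.
apply: eq_bigr => i _; rewrite -!sumrB -!big_split /=.
by apply: eq_bigr => m _; rewrite /Q collocQE; ring.
Qed.

Lemma surface_term_inflow (R : realType) (g : R) (flux : num_flux R) (k : 'I_2)
    (zin zext : pt_data R) :
  entropy_flux g flux k zin zext + 2^-1 * entropy_prod g flux k zext zin =
  dotc (sw_entropy_vars g zin) (flux k zin zext) - jflux_potential g zin k.
Proof. by rewrite /entropy_flux /entropy_prod; field. Qed.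

Lemma surface_term_outflow (R : realType) (g : R) (flux : num_flux R) (k : 'I_2)
    (zin zext : pt_data R) :
  - entropy_flux g flux k zin zext + 2^-1 * entropy_prod g flux k zin zext =
  - dotc (sw_entropy_vars g zin) (flux k zin zext) + jflux_potential g zin k.
Proof. by rewrite /entropy_flux /entropy_prod; field. Qed.

(** The boundary potentials produced by the volume terms are exactly those that
    the surface terms lack. *)
Lemma line_balance (R : realType) (N : nat) (xi : 'I_N.+1 -> R) (g : R)
    (fvol fint : num_flux R) (k : 'I_2) (z : 'I_N.+1 -> pt_data R)
    (z0 zN : pt_data R) :
  (0 < N)%N -> lgl_nodes xi ->
  \sum_i dotc (sw_entropy_vars g (z i))
    (- (\sum_m collocS xi i m *: fvol k (z i) (z m))
     + (i == ord0)%:R *: fint k (z ord0) z0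
     - (i == ord_max)%:R *: fint k (z ord_max) zN) =
  entropy_flux g fint k (z ord0) z0 - entropy_flux g fint k (z ord_max) zN
  + 2^-1 * (entropy_prod g fint k z0 (z ord0)
            + entropy_prod g fint k (z ord_max) zN)
  + \sum_i \sum_m lgl_weight xi i *
      (collocD xi i m * entropy_prod g fvol k (z i) (z m)).
Proof.
move=> N_gt0 xi_lgl.
pose a i m := dotc (sw_entropy_vars g (z i)) (fvol k (z i) (z m)).
have := flux_difference_line a (fun i => jflux_potential g (z i) k) N_gt0 xi_lgl.
set P := \sum_i \sum_m lgl_weight xi i * _ => volume.
rewrite mulrDr [X in X + _]addrACA surface_term_inflow surface_term_outflow.
under eq_bigr => i _.
  rewrite !dotcD !dotcN !dotcZ dotc_sum.
  under eq_bigr do rewrite dotcZ -/(a _ _).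
  over.
rewrite !big_split /= !sumrN volume !sum_delta /=; ring.
Qed.

Lemma is_derive_sum_fun (R : realType) n (F : 'I_n -> R -> R) (t : R)
    (d : 'I_n -> R) :
  (forall i, is_derive t 1 (F i) (d i)) ->
  is_derive t 1 (fun s => \sum_i F i s) (\sum_i d i).
Proof.
move=> dF; have -> : (fun s => \sum_i F i s) = \sum_i F i.
  by apply/funext => s; rewrite fct_sumE.
exact: is_derive_sum.
Qed.

Theorem theorem2 (R : realType)
  (N : nat) (N_gt0 : (0 < N)%N)
  (xi : 'I_N.+1 -> R) (xi_lgl : lgl_nodes xi)
  (E : set 'rV[R]_3) (X : 'rV[R]_2 -> 'rV[R]_3)
  (X_smooth : smooth_near (@ref_square R) X)
  (X_bij : set_bij (@ref_square R) E X)
  (G_spd : forall p, ref_square p -> sym_posdef (metric_mx X p))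
  (g : R) (g_gt0 : 0 < g)
  (b f : 'rV[R]_2 -> R)
  (fvol fint : num_flux R)
  (* time domain, and nodal and external solution values *)
  (T : set R) (T_open : open T)
  (u : 'I_N.+1 -> 'I_N.+1 -> R -> 'cV[R]_3)
  (u_depth : forall i j t, T t -> 0 < depth (u i j t))
  (u_derivable : forall i j t, T t -> derivable (u i j) t 1)
  (uext : side -> 'I_N.+1 -> R -> 'cV[R]_3)
  (Gext : side -> 'I_N.+1 -> 'M[R]_2) (bext : side -> 'I_N.+1 -> R)
  (uext_depth : forall e i t, T t -> 0 < depth (uext e i t))
  (Gext_spd : forall e i, sym_posdef (Gext e i)) :
  let w := lgl_weight xi in
  let S := collocS xi in
  let D := collocD xi in
  let p := gridpt xi in
  let J i j := areaJ (metric_mx X (p i j)) in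
  let z i j t := PtData (u i j t) (metric_mx X (p i j)) (b (p i j)) in
  let zext e i t := PtData (uext e i t) (Gext e i) (bext e i) in
  (* the semi-discretization *)
  (forall i j t, T t ->
    (w i * w j * J i j) *: 'D_1 (u i j) t =
      w j *: (- (\sum_m S i m *: fvol 0 (z i j t) (z m j t))
              + (i == ord0)%:R *: fint 0 (z ord0 j t) (zext West j t)
              - (i == ord_max)%:R *: fint 0 (z ord_max j t) (zext East j t))
      + w i *: (- (\sum_m S j m *: fvol 1 (z i j t) (z i m t))
              + (j == ord0)%:R *: fint 1 (z i ord0 t) (zext South i t)
              - (j == ord_max)%:R *: fint 1 (z i ord_max t) (zext North i t))
      + (w i * w j * J i j) *: sw_source X f (p i j) (u i j t)) ->
  forall t, T t ->
  is_derive t (1 : R)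
    (fun s => \sum_i \sum_j w i * w j * J i j *
       sw_entropy g (metric_mx X (p i j)) (b (p i j)) (u i j s) : R^o)
    (\sum_j w j * (entropy_flux g fint 0 (z ord0 j t) (zext West j t)
                   - entropy_flux g fint 0 (z ord_max j t) (zext East j t))
     + \sum_i w i * (entropy_flux g fint 1 (z i ord0 t) (zext South i t)
                   - entropy_flux g fint 1 (z i ord_max t) (zext North i t))
     + 2^-1 * (\sum_j w j *
         (entropy_prod g fint 0 (zext West j t) (z ord0 j t)
          + entropy_prod g fint 0 (z ord_max j t) (zext East j t)))
     + 2^-1 * (\sum_i w i *
         (entropy_prod g fint 1 (zext South i t) (z i ord0 t)
          + entropy_prod g fint 1 (z i ord_max t) (zext North i t)))
     + \sum_i \sum_j \sum_m w i * w j *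
         (D i m * entropy_prod g fvol 0 (z i j t) (z m j t)
          + D j m * entropy_prod g fvol 1 (z i j t) (z i m t))).
Proof.
move=> w S D p J z zext scheme t Tt.
have grid_in i j : ref_square (p i j).
  by move=> k; rewrite mxE in_itv; case: ifP => _; exact: lgl_nodes_itv.
have depth_neq0 i j : depth (u i j t) != 0 by rewrite gt_eqF ?u_depth.
pose W i j := sw_entropy_vars g (z i j t).
pose rhs1 i j := - (\sum_m S i m *: fvol 0 (z i j t) (z m j t))
  + (i == ord0)%:R *: fint 0 (z ord0 j t) (zext West j t)
  - (i == ord_max)%:R *: fint 0 (z ord_max j t) (zext East j t).
pose rhs2 i j := - (\sum_m S j m *: fvol 1 (z i j t) (z i m t))
  + (j == ord0)%:R *: fint 1 (z i ord0 t) (zext South i t)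
  - (j == ord_max)%:R *: fint 1 (z i ord_max t) (zext North i t).
have node_rate i j : is_derive t (1 : R)
    (fun s => w i * w j * J i j *
       sw_entropy g (metric_mx X (p i j)) (b (p i j)) (u i j s) : R^o)
    (w j * dotc (W i j) (rhs1 i j) + w i * dotc (W i j) (rhs2 i j)).
  have du : is_derive t (1 : R) (u i j) ('D_1 (u i j) t).
    by split; first exact: u_derivable.
  have := is_deriveZ (w i * w j * J i j) (is_derive_sw_entropy g
    (metric_mx X (p i j)) (b (p i j)) (depth_neq0 i j) du).
  move/is_derive_eq; apply.
  rewrite -(dotc_entropy_vars g (z := z i j t)); last exact: depth_neq0.
  rewrite -/(W i j).
  transitivity (dotc (W i j) ((w i * w j * J i j) *: 'D_1 (u i j) t)).
    by rewrite dotcZ.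
  rewrite scheme // -/(rhs1 i j) -/(rhs2 i j) dotcD dotcD !dotcZ.
  by rewrite sw_source_orthogonal ?mulr0 ?addr0 //; exact: G_spd (grid_in i j).
have := is_derive_sum_fun (fun i => is_derive_sum_fun (fun j => node_rate i j)).
move/is_derive_eq; apply.
have west_east j := line_balance g fvol fint 0 (fun i => z i j t)
  (zext West j t) (zext East j t) N_gt0 xi_lgl.
have south_north i := line_balance g fvol fint 1 (fun j => z i j t)
  (zext South i t) (zext North i t) N_gt0 xi_lgl.
pose vol1 i j m := D i m * entropy_prod g fvol 0 (z i j t) (z m j t).
pose vol2 i j m := D j m * entropy_prod g fvol 1 (z i j t) (z i m t).
have -> : \sum_i \sum_j \sum_m w i * w j * (vol1 i j m + vol2 i j m) =
    \sum_j w j * (\sum_i \sum_m w i * vol1 i j m)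
    + \sum_i w i * (\sum_j \sum_m w j * vol2 i j m).
  under [X in _ = X + _]eq_bigr do rewrite mulr_sumr.
  rewrite [X in _ = X + _]exchange_big -big_split /=; apply: eq_bigr => i _.
  rewrite [X in _ + X]mulr_sumr -big_split /=; apply: eq_bigr => j _.
  rewrite !mulr_sumr -big_split /=; apply: eq_bigr => m _; ring.
have regroup (c x y v : R) : c * (x + 2^-1 * y + v) = c * x + 2^-1 * (c * y) + c * v.
  by ring.
under eq_bigr do rewrite big_split.
rewrite big_split /= [X in X + _ = _]exchange_big /=.
under eq_bigr do rewrite -mulr_sumr west_east regroup.
under [X in _ + X = _]eq_bigr do rewrite -mulr_sumr south_north regroup.
rewrite !big_split /= -!mulr_sumr -/w -/D.
ring.
Qed.
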